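(* Let $n\ge 1$ and $N\ge 1$ be integers, let $h>0$, and let $T=mh$ for some integer $m\ge 1$. Assume $F:\mathcal{H}_n\to\mathbb{R}$ is monotone, has width $N$, and satisfies $F(0)=0$. Let $u,v:\mathbb{Z}_h^n\to\mathbb{R}$ satisfy $$u-F(\nabla_h^2u)\le v-F(\nabla_h^2 v)\quad\text{on } \Omega_{T,h}.$$ Then for any $\alpha\in(0,1)$ we have $$\max_{\Omega_{\alpha T,h}}(u-v)\le \frac{C\,\mathrm{Lip}_N(F)N^2}{(1-\alpha)^2T^2}\left(\left(\log\left(\frac{T^2}{\mathrm{Lip}_N(F)N^2}\right)\right)^2+1\right)\max_{\partial_N\Omega_{T,h}}(u-v),$$ where $C$ is a constant.
   Context: Grid: $\mathbb{Z}_h=h\mathbb{Z}$ and $\mathbb{Z}_h^n=(h\mathbb{Z})^n$, where $h>0$ is the grid spacing. $\mathcal{H}_n$ is the set of all functions $X:\mathbb{Z}^n\to\mathbb{R}$. For $u:\mathbb{Z}_h^n\to\mathbb{R}$, $x\in\mathbb{Z}_h^n$, $\mathbf{v}\in\mathbb{Z}^n$, the discrete Hessian is $\nabla_h^2u(x,\mathbf{v})=\frac{u(x+h\mathbf{v})-2u(x)+u(x-h\mathbf{v})}{h^2}$, and $\nabla_h^2u(x)\in\mathcal{H}_n$ denotes the map $\mathbf{v}\mapsto\nabla_h^2u(x,\mathbf{v})$; $F(\nabla_h^2u)$ is the function $x\mapsto F(\nabla_h^2u(x))$. $F:\mathcal{H}_n\to\mathbb{R}$ is monotone if $X\le Y$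 pointwise implies $F(X)\le F(Y)$. Let $|\mathbf{v}|_\infty=\max_i|v_i|$ and $\|X\|_{N,\infty}=\max\{|X(\mathbf{v})|:\mathbf{v}\in\mathbb{Z}^n,|\mathbf{v}|_\infty\le N\}$. $F$ has width $N$ if there is $C>0$ with $|F(X)-F(Y)|\le C\|X-Y\|_{N,\infty}$ for all $X,Y\in\mathcal{H}_n$; the smallest such constant is denoted $\mathrm{Lip}_N(F)$. For $S>0$, $\Omega_{S,h}=[-S,S]^n\cap\mathbb{Z}_h^n$. The width $N$ boundary is $\partial_N\Omega_{T,h}=\{x\in\mathbb{Z}_h^n\setminus\Omega_{T,h}:\text{there exists }y\in\Omega_{T,h}\text{ with }|x-y|_\infty\le N\}$.
   Formalization: The boundary maximum is replaced by max(0, boundary maximum); for h > 1 the boundary uses |x−y|_∞ ≤ Nh instead of N (for h ≤ 1 both versions are proved); C may depend on n. The literal claim fails without these changes. *)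

(* Defs.v *)
From HB Require Import structures.
From mathcomp Require Import all_boot all_order all_algebra.
From mathcomp Require Import all_classical all_reals all_analysis.

Set Implicit Arguments.
Unset Strict Implicit.
Unset Printing Implicit Defensive.

Import Order.TTheory GRing.Theory Num.Theory.
Import numFieldNormedType.Exports.

Local Open Scope classical_set_scope.
Local Open Scope ring_scope.

(* On matrices, hence on the row vectors below, `|.| is the maximum norm. *)

(* The functions on the lattice Z^n. *)
Definition Hfun (R : realType) (n : nat) : Type := 'rV[int]_n -> R.

(* The embedding of Z^n in R^n. *)
Definition intvec (R : realType) (n : nat) (z : 'rV[int]_n) : 'rV[R]_n :=
  map_mx intr z.

Definition grid (R : realType) (n : nat) (h : R) : set 'rV[R]_n :=
  [set x | exists z : 'rV[int]_n, x = h *: intvec R z].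

(* A grid function is the restriction of some u : 'rV[R]_n -> R to [grid h];
   when x is a grid point only values of u on the grid occur in [hessian]. *)
Definition hessian (R : realType) (n : nat) (h : R) (u : 'rV[R]_n -> R)
    (x : 'rV[R]_n) : Hfun R n :=
  fun v => (u (x + h *: intvec R v) - 2 * u x + u (x - h *: intvec R v))
           / h ^+ 2.

(* [max_on] is only used below for nonempty finite A: the supremum is then
   attained. *)
Definition max_on (R : realType) (T : Type) (A : set T) (f : T -> R) : R :=
  sup [set f x | x in A].

Definition monotone_op (R : realType) (n : nat) (F : Hfun R n -> R) : Prop :=
  forall X Y : Hfun R n, (forall v, X v <= Y v) -> F X <= F Y.

Definition norm_width (R : realType) (n N : nat) (X : Hfun R n) : R :=
  max_on [set v : 'rV[int]_n | `|v| <= N%:Z] (fun v => `|X v|).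

Definition width_constants (R : realType) (n N : nat) (F : Hfun R n -> R)
    : set R :=
  [set C | 0 < C /\
    forall X Y : Hfun R n, `|F X - F Y| <= C * norm_width N (X \- Y)].

Definition has_width (R : realType) (n N : nat) (F : Hfun R n -> R) : Prop :=
  exists C : R, width_constants N F C.

(* The infimum belongs to [width_constants N F], except when F is constant:
   it is then 0. *)
Definition Lip (R : realType) (n N : nat) (F : Hfun R n -> R) : R :=
  inf (width_constants N F).

Definition box (R : realType) (n : nat) (h S : R) : set 'rV[R]_n :=
  [set x | grid h x /\ forall i, - S <= x 0 i <= S].

(* W is a distance in R^n; a boundary of k grid layers is W = k * h. *)
Definition boundary (R : realType) (n : nat) (h T W : R) : set 'rV[R]_n :=
  [set x | [/\ grid h x, ~ box h T x &
               exists2 y, box h T y & `|x - y| <= W]].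

(* Main.v *)
Require Import Defs.
From mathcomp Require Import all_boot all_order all_algebra.
From mathcomp Require Import all_classical all_reals all_analysis.
From mathcomp Require Import zify lra ring.

Import Order.TTheory GRing.Theory Num.Theory.
Import numFieldNormedType.Exports.

Local Open Scope ring_scope.

(* Centre a quadratic barrier at a point x0 of the inner box: the function
   M (|x - x0|_2^2 / d^2 + 2 n L N^2 / d^2), with d = (1 - alpha) T, is at
   least M outside the outer box, where some coordinate of x - x0 exceeds d,
   and its second differences of width N are at most 2 n N^2 M / d^2 for every
   h.  By monotonicity and the Lipschitz bound it is a supersolution, so the
   discrete maximum principle bounds (u - v)(x0) by 2 n L N^2 M / d^2.  This is
   stronger than the claim, since the logarithmic factor is at least 1. *)

Lemma mx_norm_leP (K : realDomainType) (n : nat) (x : 'rV[K]_n) (c : K) :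
  0 <= c -> reflect (forall i, `|x 0 i| <= c) (`|x| <= c).
Proof.
move=> c0; rewrite [X in X <= _]/Num.norm /= mx_normrE; apply: (iffP idP) => [xc i|xc].
  by have /bigmax_leP[_ /(_ (0, i) isT)] := xc.
by apply/bigmax_leP; split=> // -[j i] _; rewrite (ord1 j) xc.
Qed.

(** * Finite sets of grid points and maxima over finite sets *)

Lemma finite_int_ball (n k : nat) :
  finite_set [set z : 'rV[int]_n | forall i, `|z 0 i| <= k%:Z]%classic.
Proof.
pose f (t : 'rV['I_(k + k).+1]_n) : 'rV[int]_n := \row_i ((t 0 i)%:Z - k%:Z).
apply: (@sub_finite_set _ _ (f @` setT)%classic); last first.
  by apply: finite_image; exact: finite_finset.
move=> z zk; exists (\row_i inord `|(z 0 i + k%:Z)%R|%N) => //.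
apply/rowP => i; have zik : `|z 0 i| <= k%:Z := zk i.
rewrite !mxE inordK; last by lia.
by rewrite gez0_abs; lia.
Qed.

Lemma finite_grid_ball (R : realType) (n : nat) (h B : R) : 0 < h ->
  finite_set [set x : 'rV[R]_n | grid h x /\ forall i, `|x 0 i| <= B]%classic.
Proof.
move=> h0.
pose k := `|Num.ceil (B / h)|%N.
apply: (sub_finite_set _ (finite_image (fun z => h *: intvec R z)
  (finite_int_ball n k))).
move=> x [[z ->] zB]; exists z => // i /=.
have := zB i; rewrite !mxE normrM gtr0_norm // mulrC -ler_pdivlMr // => zi.
rewrite -(ler_int R) intr_norm (le_trans zi) // (le_trans (ceil_ge _)) //.
by rewrite ler_int abszE ler_norm.
Qed.

Lemma finite_argmax (R : realType) (T : eqType) (A : set T) (f : T -> R) :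
  finite_set A -> (A !=set0)%classic ->
  exists2 x, A x & forall y, A y -> f y <= f x.
Proof.
move=> /finite_seqP[s ->] {A} [a sa].
suff: forall s : seq T, s != [::] ->
    exists2 x, x \in s & forall y, y \in s -> f y <= f x.
  by move=> /(_ s); apply; apply/eqP => s0; move: sa; rewrite /= s0.
elim=> // b {sa}[|c t] IH _.
  by exists b; rewrite ?mem_head // => y; rewrite inE => /eqP ->.
have [//|x xt xmax] := IH.
have [fbx|/ltW fxb] := leP (f b) (f x).
  exists x; first by rewrite inE xt orbT.
  by move=> y; rewrite inE => /predU1P[->//|/xmax].
exists b; first exact: mem_head.
by move=> y; rewrite inE => /predU1P[->//|/xmax /le_trans]; exact.
Qed.

(** Finiteness supplies the upper bound without which [sup] is only a default value. *)
Lemma le_max_on (R : realType) (T : eqType) (A : set T) (f : T -> R) (x : T) :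
  finite_set A -> A x -> f x <= max_on A f.
Proof.
move=> finA Ax; apply: ub_le_sup; last by exists x.
have [|y Ay ymax] := @finite_argmax _ _ _ f finA; first by exists x.
by exists (f y) => _ [z Az <-]; exact: ymax.
Qed.

Lemma max_on_le (R : realType) (T : Type) (A : set T) (f : T -> R) (c : R) :
  (A !=set0)%classic -> (forall x, A x -> f x <= c) -> max_on A f <= c.
Proof.
move=> [a Aa] fc; apply: ge_sup; first by exists (f a); exists a.
by move=> _ [x /fc fxc <-].
Qed.

(** * Estimates of F through its Lipschitz constant *)

Lemma norm_width_le (R : realType) (n N : nat) (X : Hfun R n) (c : R) :
  (forall v : 'rV[int]_n, `|v| <= N%:Z -> `|X v| <= c) -> norm_width N X <= c.
Proof.
move=> Xc; apply: max_on_le => //.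
by exists 0 => /=; rewrite normr0.
Qed.

Lemma Lip_ge0 (R : realType) (n N : nat) (F : Hfun R n -> R) :
  has_width N F -> 0 <= Lip N F.
Proof. by move=> wF; apply: lb_le_inf => // C [/ltW]. Qed.

(** For constant F the infimum [Lip N F] is not itself a width constant, so the estimate is proved
    for each width constant and then passed to the infimum after dividing by c. *)
Lemma Lip_bound (R : realType) (n N : nat) (F : Hfun R n -> R)
    (X Y : Hfun R n) (c : R) : has_width N F -> 0 <= c ->
  (forall v : 'rV[int]_n, `|v| <= N%:Z -> `|X v - Y v| <= c) ->
  F X - F Y <= Lip N F * c.
Proof.
move=> wF; rewrite le_eqVlt => c0 XYc.
have bnd C : width_constants N F C -> F X - F Y <= C * c.
  move=> [C0 FC]; rewrite (le_trans (ler_norm _)) // (le_trans (FC _ _)) //.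
  by rewrite ler_pM2l // norm_width_le.
(* Division by c is impossible when c = 0; there any single width constant gives the bound. *)
case/predU1P: c0 => [c0|c0].
  by have [C /bnd] := wF; rewrite -c0 !mulr0.
rewrite -ler_pdivrMr //; apply: lb_le_inf => // C /bnd.
by rewrite ler_pdivrMr.
Qed.

(* The competitor max(X, Y + c) dominates X everywhere, and equals Y + c where
   [norm_width N] looks. *)
Lemma monotone_Lip_bound (R : realType) (n N : nat) (F : Hfun R n -> R)
    (X Y : Hfun R n) (c : R) : monotone_op F -> has_width N F -> 0 <= c ->
  (forall v : 'rV[int]_n, `|v| <= N%:Z -> X v - Y v <= c) ->
  F X - F Y <= Lip N F * c.
Proof.
move=> mF wF c0 XYc.
pose Z : Hfun R n := fun v => Num.max (X v) (Y v + c).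
have XZ : F X <= F Z by apply: mF => v; rewrite le_max lexx.
rewrite (le_trans (lerB XZ (lexx _))) //; apply: Lip_bound => // v vN.
rewrite /Z max_r; last by have := XYc v vN; lra.
by rewrite addrAC subrr add0r ger0_norm.
Qed.

(** * Grid geometry and the quadratic barrier *)

Lemma grid_shift (R : realType) (n : nat) (h : R) (x : 'rV[R]_n)
  (z : 'rV[int]_n) : grid h x -> grid h (x + h *: intvec R z).
Proof.
move=> [y ->]; exists (y + z); rewrite -scalerDr; congr (_ *: _).
by apply/rowP => i; rewrite !mxE intrD.
Qed.

Lemma finite_box (R : realType) (n : nat) (h S : R) : 0 < h ->
  finite_set (@box R n h S).
Proof.
move=> h0; apply: sub_finite_set (@finite_grid_ball R n h S h0).
by move=> x [gx xS]; split=> // i; rewrite ler_norml.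
Qed.

Lemma finite_boundary (R : realType) (n : nat) (h S W : R) : 0 < h -> 0 <= W ->
  finite_set (@boundary R n h S W).
Proof.
move=> h0 W0; apply: sub_finite_set (@finite_grid_ball R n h (S + W) h0).
move=> x [gx _ [y [_ yS]] /(mx_norm_leP _ _ _ _ W0) xyW]; split=> // i.
by have := yS i; have := xyW i; rewrite !mxE !ler_norml; lra.
Qed.

(** This keeps the width N stencil of a box point inside the finite set over which the maximum
    principle maximises. *)
Lemma box_or_boundary (R : realType) (n N : nat) (h T : R) (x : 'rV[R]_n)
    (z : 'rV[int]_n) : 0 < h -> box h T x -> `|z| <= N%:Z ->
  (box h T `|` boundary h T (N%:R * h))%classic (x + h *: intvec R z).
Proof.
move=> h0 Bx /mx_norm_leP zN.
have [Bxz|nBxz] := pselect (box h T (x + h *: intvec R z)); [by left|right].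
split=> //; first by apply: grid_shift; case: Bx.
exists x => //; rewrite addrAC subrr add0r; apply/mx_norm_leP => [|i].
  by rewrite mulr_ge0 // ltW.
rewrite !mxE normrM gtr0_norm // mulrC ler_pM2r //.
by rewrite -intr_norm -[N%:R]/(N%:Z%:~R) ler_int zN.
Qed.

(** The parallelogram law: second differences of the squared Euclidean norm do not depend on the
    base point. *)
Lemma sum_sqr_shift (R : realType) (n : nat) (y z : 'rV[R]_n) :
  \sum_i ((y + z) 0 i) ^+ 2 + \sum_i ((y - z) 0 i) ^+ 2
  = 2 * \sum_i (y 0 i) ^+ 2 + 2 * \sum_i (z 0 i) ^+ 2.
Proof.
rewrite !mulr_sumr -!big_split; apply: eq_bigr => i _ /=.
by rewrite !mxE; ring.
Qed.

Lemma sum_sqr_intvec_le (R : realType) (n N : nat) (z : 'rV[int]_n) :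
  `|z| <= N%:Z -> \sum_i (intvec R z 0 i) ^+ 2 <= n%:R * N%:R ^+ 2.
Proof.
move=> /mx_norm_leP zN.
rewrite -[n in n%:R]card_ord -sum1_card natr_sum mulr_suml.
apply: ler_sum => i _; rewrite mul1r -real_normK ?num_real //.
rewrite ler_sqr ?nnegrE // !mxE -intr_norm -[N%:R]/(N%:Z%:~R) ler_int.
exact: zN.
Qed.

Lemma comparison_at (R : realType) (n N : nat) (h T d M : R)
    (F : Hfun R n -> R) (u v : 'rV[R]_n -> R) (x0 : 'rV[R]_n) :
  0 < h -> 0 < d -> 0 <= M -> monotone_op F -> has_width N F ->
  (forall x, box h T x ->
     u x - F (hessian h u x) <= v x - F (hessian h v x)) ->
  box h T x0 ->
  (forall x, ~ box h T x -> grid h x -> exists i, d <= `|(x - x0) 0 i|) ->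
  (forall x, boundary h T (N%:R * h) x -> u x - v x <= M) ->
  u x0 - v x0 <= Lip N F * (2 * n%:R * N%:R ^+ 2 / d ^+ 2 * M).
Proof.
move=> h0 d0 M0 mF wF uv Bx0 far uvM.
set c := 2 * n%:R * N%:R ^+ 2 / d ^+ 2 * M.
have d20 : 0 < d ^+ 2 by rewrite exprn_gt0.
have c0 : 0 <= c by rewrite /c !mulr_ge0 ?invr_ge0 ?exprn_ge0 // ltW.
pose q (x : 'rV[R]_n) := \sum_i ((x - x0) 0 i) ^+ 2.
have q0 x : 0 <= q x by apply: sumr_ge0 => i _; exact: sqr_ge0.
pose a := M / d ^+ 2.
have a0 : 0 <= a by rewrite divr_ge0 // ltW.
have qx0 : q x0 = 0.
  by apply: big1 => i _; rewrite !mxE subrr expr0n.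
(* The barrier enters without its additive constant: since q vanishes at x0, it suffices to bound
   the maximum of u - v - a q by [Lip N F * c]. *)
have /(finite_argmax _ _ _ (fun x => u x - v x - a * q x))[] :
    finite_set (box h T `|` @boundary R n h T (N%:R * h))%classic.
- rewrite finite_setU; split; first exact: finite_box.
  by apply: finite_boundary => //; rewrite mulr_ge0 // ltW.
- by exists x0; left.
move=> x1 Bx1 x1max; have := x1max x0 (or_introl Bx0).
rewrite qx0 mulr0 subr0 => /le_trans; apply.
(* At a boundary maximiser a q is at least M, so the maximum is at most 0. *)
case: Bx1 => [Bx1|bx1]; last first.
  have [gx nBx _] := bx1; have [i xi] := far _ nBx gx.
  have dq : d ^+ 2 <= q x1.
    rewrite (le_trans (_ : _ <= `|(x1 - x0) 0 i| ^+ 2)) //.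
      by rewrite ler_sqr ?nnegrE // ltW.
    rewrite real_normK ?num_real // /q (bigD1 i) //= lerDl.
    by apply: sumr_ge0 => j _; exact: sqr_ge0.
  have : M <= a * q x1.
    by rewrite /a mulrAC ler_pdivlMr // ler_wpM2l.
  have := uvM _ bx1; have := mulr_ge0 (Lip_ge0 _ _ _ _ wF) c0; lra.
(* At a maximiser in the box, adding the maximality inequalities at x1 + h z and x1 - h z bounds the
   second difference of u - v by that of a q. *)
have hess (z : 'rV[int]_n) : `|z| <= N%:Z ->
    hessian h u x1 z - hessian h v x1 z <= c.
  move=> zN; rewrite /hessian -mulrBl ler_pdivrMr ?exprn_gt0 //.
  have nzN : `|- z| <= N%:Z by rewrite normrN.
  have := x1max _ (box_or_boundary _ _ _ _ _ _ _ h0 Bx1 zN).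
  have := x1max _ (box_or_boundary _ _ _ _ _ _ _ h0 Bx1 nzN).
  have -> : h *: intvec R (- z) = - (h *: intvec R z).
    by apply/rowP => i; rewrite !mxE intrN mulrN.
  set y := h *: intvec R z => yp ym.
  have qE : q (x1 + y) + q (x1 - y) = 2 * q x1 + 2 * \sum_i (y 0 i) ^+ 2.
    by rewrite /q -sum_sqr_shift [x1 + y - x0]addrAC [x1 - y - x0]addrAC.
  have yN : \sum_i (y 0 i) ^+ 2 <= h ^+ 2 * (n%:R * N%:R ^+ 2).
    have -> : \sum_i (y 0 i) ^+ 2 = h ^+ 2 * \sum_i (intvec R z 0 i) ^+ 2.
      by rewrite mulr_sumr; apply: eq_bigr => i _; rewrite mxE exprMn.
    by rewrite ler_wpM2l ?exprn_ge0 ?sum_sqr_intvec_le // ltW.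
  have cE : c * h ^+ 2 = 2 * (a * (h ^+ 2 * (n%:R * N%:R ^+ 2))).
    by rewrite /c /a; ring.
  have := ler_wpM2l a0 yN; have := congr1 ( *%R a) qE.
  rewrite cE !mulrDr !(mulrCA a 2); lra.
(* The inequality between u and v at x1 turns the bound on the difference of the F values into one
   on u - v; subtracting a q only lowers the left side. *)
have := monotone_Lip_bound _ _ _ _ _ _ _ mF wF c0 hess.
have := uv _ Bx1; have := mulr_ge0 a0 (q0 x1); lra.
Qed.

Theorem theorem2p19 (R : realType) (n : nat) (hn : (1 <= n)%N) :
  exists C : R, 0 < C /\
  forall (N : nat) (h T : R) (m : nat) (F : Hfun R n -> R)
         (u v : 'rV[R]_n -> R),
    (1 <= N)%N -> 0 < h -> (1 <= m)%N -> T = m%:R * h ->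
    monotone_op F -> has_width N F -> F (fun _ => 0) = 0 ->
    (forall x, box h T x ->
       u x - F (hessian h u x) <= v x - F (hessian h v x)) ->
    forall alpha : R, 0 < alpha -> alpha < 1 ->
    let L := Lip N F in
    let K := C * L * N%:R ^+ 2 / ((1 - alpha) ^+ 2 * T ^+ 2) *
             ((ln (T ^+ 2 / (L * N%:R ^+ 2))) ^+ 2 + 1) in
    max_on (box h (alpha * T)) (u \- v)
      <= K * Num.max 0 (max_on (boundary h T (N%:R * h)) (u \- v))
    /\
    (h <= 1 ->
     max_on (box h (alpha * T)) (u \- v)
       <= K * Num.max 0 (max_on (boundary h T N%:R) (u \- v))).
Proof.
exists (2 * n%:R); split; first by rewrite mulr_gt0 ?ltr0n.
move=> N h T m F u v N1 h0 m1 TE mF wF _ uv alpha alpha0 alpha1 L K.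
have T0 : 0 < T by rewrite TE mulr_gt0 ?ltr0n.
pose d := (1 - alpha) * T.
have d0 : 0 < d by rewrite mulr_gt0 ?subr_gt0.
(* Both conclusions are instances: W = N h, and W = N when h <= 1. *)
have bound W : N%:R * h <= W -> max_on (box h (alpha * T)) (u \- v)
    <= K * Num.max 0 (max_on (boundary h T W) (u \- v)).
  move=> NhW; set M := Num.max _ _.
  have M0 : 0 <= M by rewrite le_max lexx.
  have W0 : 0 <= W by rewrite (le_trans _ NhW) // mulr_ge0 // ltW.
  have alphaT0 : 0 <= alpha * T by rewrite mulr_ge0 // ltW.
  apply: max_on_le.
    exists 0; split; last by move=> i; rewrite !mxE oppr_le0 alphaT0.
    by exists 0; apply/rowP => i; rewrite !mxE mulr0.
  move=> x0 [gx0 x0alpha].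
  have alphaTT : alpha * T <= T by rewrite ger_pMl // ltW.
  have Bx0 : box h T x0.
    by split=> // i; have := x0alpha i; lra.
  have far x : ~ box h T x -> grid h x -> exists i, d <= `|(x - x0) 0 i|.
    (* Were all coordinates of x - x0 below d in absolute value, those of x would be at most alpha T
       + (1 - alpha) T = T. *)
    move=> nBx gx; apply: contrapT => /forallNP near; apply: nBx; split=> // i.
    have /negP := near i; rewrite -ltNge !mxE ltr_norml /d.
    by have := x0alpha i; lra.
  have bM x : boundary h T (N%:R * h) x -> u x - v x <= M.
    move=> [gx nBx [y By xy]]; rewrite /M le_max; apply/orP; right.
    apply: (le_max_on _ _ _ (u \- v)); first exact: finite_boundary.
    by split=> //; exists y => //; exact: le_trans NhW.
  apply: le_trans (comparison_at _ _ _ _ _ _ _ _ _ _ _ h0 d0 M0 mF wF uv Bx0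
    far bM) _.
  rewrite mulrA ler_wpM2r // /K -exprMn -/d -/L.
  have -> : L * (2 * n%:R * N%:R ^+ 2 / d ^+ 2)
      = 2 * n%:R * L * N%:R ^+ 2 / d ^+ 2 by ring.
  (* A square plus 1 is at least 1 whatever [ln] returns, including when L = 0 and the quotient is 0
     by convention. *)
  rewrite ler_peMr ?lerDr ?sqr_ge0 //.
  by rewrite !mulr_ge0 ?invr_ge0 ?exprn_ge0 ?(ltW d0) ?Lip_ge0.
split; first exact: bound.
by move=> h1; apply: bound; rewrite ler_piMr.
Qed.
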